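(* Let $\{c_n\}_{n=1}^{\infty}$ be a real sequence and let $\{d_{n+1}\}_{n=1}^{\infty}$ be a positive chain sequence (these being the coefficients of the recurrence $R_{n+1}(z)=[(1+ic_{n+1})z+(1-ic_{n+1})]R_n(z)-4d_{n+1}zR_{n-1}(z)$, $n\ge 1$, $R_0(z)=1$, $R_1(z)=(1+ic_1)z+(1-ic_1)$). Let $\{M_{n+1}\}_{n=0}^{\infty}$ be the maximal parameter sequence of $\{d_{n+1}\}_{n=1}^{\infty}$ (so $d_{n+1}=(1-M_n)M_{n+1}$, $n\ge1$), with $M_1>0$. Let $0\le t<1$, put $d_1=(1-t)M_1$, and let $\{m_n^{(t)}\}_{n=0}^{\infty}$ be the minimal parameter sequence of the augmented positive chain sequence $\{d_n\}_{n=1}^{\infty}$. Let $\{a_n\}_{n=1}^{\infty}$ be the complementary chain sequence of $\{d_n\}_{n=1}^{\infty}$ and let $\{k_n^{(t)}\}_{n=0}^{\infty}$ be its minimal parameter sequence. Set $\tau_0=1$, $\tau_n=\frac{1-ic_n}{1+ic_n}\tau_{n-1}$, and $$\alpha_{n-1}^{(t)}=\overline{\tau}_n\left[\frac{1-2m_n^{(t)}-ic_n}{1+ic_n}\right],\qquad \beta_{n-1}^{(t)}=\overline{\tau}_n\left[\frac{1-2k_n^{(t)}-ic_n}{1+ic_n}\right],\qquad n\ge1.$$ Let $\mu^{(t)}$ and $\nu^{(t)}$ be the probability measures on the unit circle whose Verblunsky coefficients are $\{\alpha_{n-1}^{(t)}\}_{n\ge1}$ and $\{\beta_{n-1}^{(t)}\}_{n\ge1}$,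 respectively. Then: 1. For $0<t<1$, the measure $\mu^{(t)}$ has a pure point of size $t$ at $z=1$ (i.e. $\mu^{(t)}(\{1\})=t$), while $\nu^{(t)}$ does not have a pure point at $z=1$ (i.e. $\nu^{(t)}(\{1\})=0$). 2. $\beta_{n-1}^{(t)}=-\overline{\tau}_n\,\overline{\tau}_{n-1}\,\overline{\alpha_{n-1}^{(t)}}$ for all $n\ge1$. 3. If $c_n=(-1)^nc$ for all $n\ge1$, for some $c\in\mathbb{R}$, then $\beta_{n-1}^{(t)}=-\frac{1-ic}{1+ic}\,\alpha_{n-1}^{(t)}$ for all $n\ge1$. 4. If $c_n=0$ for all $n\ge1$, then the Verblunsky coefficients are real and $\beta_{n-1}^{(t)}=-\alpha_{n-1}^{(t)}$ for all $n\ge1$.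
   Context: Positive chain sequence: a sequence $\{d_n\}_{n=1}^\infty$ for which there is a sequence $\{g_n\}_{n=0}^\infty$ (a parameter sequence) with $0\le g_0<1$, $0<g_n<1$ for $n\ge1$, and $d_n=(1-g_{n-1})g_n$ for $n\ge1$. The minimal parameter sequence $\{m_n\}_{n=0}^\infty$ is the parameter sequence with $m_0=0$. The maximal parameter sequence $\{M_n\}_{n=0}^\infty$ is the parameter sequence given by $M_n=\sup\{g_n:\{g_k\}\text{ is a parameter sequence of }\{d_n\}\}$ for each $n\ge0$. For the shifted sequence $\{d_{n+1}\}_{n=1}^\infty$ parameter sequences are indexed as $\{g_{n+1}\}_{n=0}^{\infty}$, with $0\le g_1<1$, $0<g_{n+1}<1$ and $d_{n+1}=(1-g_n)g_{n+1}$ for $n\ge1$. Complementary chain sequence: if $\{d_n\}_{n=1}^\infty$ is a positive chain sequence with minimal parameter sequence $\{m_n\}_{n=0}^\infty$, put $k_0=0$ and $k_n=1-m_n$ for $n\ge1$; the chain sequence $a_n=(1-k_{n-1})k_n$, $n\ge1$, which has $\{k_n\}_{n=0}^\infty$ as its minimal parameter sequence, is the complementary chain sequence of $\{d_n\}$. Verblunsky coefficients: for a nontrivial (infinitely supported) probability measure $\mu$ on the unit circle with monic orthogonal polynomials $\Phi_n$ (so $\int \bar z^{\,j}\Phi_n(z)\,d\mu(z)=0$ for $0\le j\le n-1$), the Verblunsky coefficients are $\alpha_{n-1}=-\overline{\Phi_n(0)}$, $n\ge1$. By Verblunsky's theorem, every sequence in the open unit disk is the Verblunsky coefficient sequence of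 a unique nontrivial probability measure on the unit circle.
   Formalization: In item 3 the printed identity fails at n=1 for every c≠0 (it would force m_1 c=0); the theorem proves the corrected identity with the complex conjugate of α_{n-1}^{(t)} in place of α_{n-1}^{(t)}, which agrees with the printed one when c=0. *)

(* Defs.v *)
From HB Require Import structures.
From mathcomp Require Import all_boot all_order all_algebra.
From mathcomp Require Import complex.
From mathcomp Require Import all_classical all_reals all_analysis.

Set Implicit Arguments.
Unset Strict Implicit.
Unset Printing Implicit Defensive.

Import Order.TTheory GRing.Theory Num.Theory numFieldNormedType.Exports.

Local Open Scope classical_set_scope.
Local Open Scope complex_scope.
Local Open Scope ring_scope.

(* A chain sequence {d_n}_{n >= 1} is represented by a function on nat whose
   value at 0 is irrelevant; a parameter sequence {g_n}_{n >= 0} uses all the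
   values of its function. *)
Definition parameter_sequence (R : realType) (d : nat -> R) : set (nat -> R) :=
  [set g | 0 <= g 0%N < 1 /\
    forall n, 0 < g n.+1 < 1 /\ d n.+1 = (1 - g n) * g n.+1].

Definition positive_chain_sequence (R : realType) (d : nat -> R) : Prop :=
  exists g, parameter_sequence d g.

Definition minimal_parameter_sequence (R : realType) (d m : nat -> R) : Prop :=
  parameter_sequence d m /\ m 0%N = 0.

(* That M is itself a parameter sequence of d, when d has one, is a theorem
   about this supremum and is not part of the definition. *)
Definition maximal_parameter_sequence (R : realType) (d M : nat -> R) : Prop :=
  forall n, M n = sup [set g n | g in parameter_sequence d].

Definition complementary_parameters (R : realType) (m : nat -> R) : nat -> R :=
  fun n => if n is 0%N then 0 else 1 - m n.

Definition complementary_chain_sequence (R : realType) (d a : nat -> R) : Prop :=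
  exists2 m, minimal_parameter_sequence d m &
    forall n, a n.+1 = (1 - complementary_parameters m n) *
                       complementary_parameters m n.+1.

(* Only c_1, c_2, ... are used. *)
Fixpoint tau (R : realType) (c : nat -> R) (n : nat) : R[i] :=
  if n is p.+1 then (1 -i* c n) / (1 +i* c n) * tau c p else 1.

(* The complex plane with its Borel sigma-algebra; R[i]^o carries the topology
   of the modulus. *)
Definition borelC (R : realType) : Type :=
  g_sigma_algebraType (@open (R[i]^o)).

Definition unit_circle (R : realType) : set (borelC R) :=
  [set z : R[i] | `|z| = 1].

(* Measures on the unit circle are measures on the plane carried by the
   circle. *)
Definition circle_probability (R : realType)
    (mu : probability (borelC R) R) : Prop :=
  mu (@unit_circle R) = 1%E.

Definition measure_support (R : realType) (mu : probability (borelC R) R) :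
    set R[i] :=
  [set z | forall U : set R[i]^o, open U -> U z -> (0 < mu U)%E].

Definition Cintegral (R : realType) (mu : probability (borelC R) R)
    (f : R[i] -> R[i]) : R[i] :=
  Rintegral mu setT (fun z => complex.Re (f z)) +i*
  Rintegral mu setT (fun z => complex.Im (f z)).

Definition monic_orthogonal_polynomials (R : realType)
    (mu : probability (borelC R) R) (Phi : nat -> {poly R[i]}) : Prop :=
  forall n, [/\ Phi n \is monic, size (Phi n) = n.+1 &
    forall j, (j < n)%N ->
      Cintegral mu (fun z => z^* ^+ j * (Phi n).[z]) = 0].

Definition verblunsky_coefficients (R : realType)
    (mu : probability (borelC R) R) (alpha : nat -> R[i]) : Prop :=
  [/\ circle_probability mu, infinite_set (measure_support mu) &
    exists2 Phi, monic_orthogonal_polynomials mu Phi &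
      forall n, alpha n = - ((Phi n.+1).[0])^*].

(* Main.v *)
(* Let Phi_n be the monic orthogonal polynomials of mu and K_n the sum of the
   |Phi_j(1)|^2 / ||Phi_j||^2, j <= n. The minimum of the integral of |p|^2 over
   the polynomials of degree at most n with p(1) = 1 is 1 / K_n, and testing with
   p(z) = ((1 + z) / 2)^n gives mu({1}) = lim 1 / K_n. For the coefficients at
   hand Szego's recurrence at z = 1 yields K_n = sum_(i <= n) prod_(j <= i)
   g_j / (1 - g_j), with g = m for mu and g = k = 1 - m for nu. By Wall's
   description of the parameter sequences of a chain sequence, the sum for m is
   1 / t, because t is the maximal initial parameter; the products for k are the
   inverses of those for m, so the sum for k diverges. *)

Require Import Defs.
From HB Require Import structures.
From mathcomp Require Import all_boot all_order all_algebra.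
From mathcomp Require Import zify ring lra.
From mathcomp Require Import complex.
From mathcomp Require Import all_classical all_reals all_analysis measurable_realfun.

Set Implicit Arguments.
Unset Strict Implicit.
Unset Printing Implicit Defensive.

Import Order.TTheory GRing.Theory Num.Theory numFieldNormedType.Exports.
Local Open Scope classical_set_scope.
Local Open Scope complex_scope.
Local Open Scope ring_scope.

(** * Chain sequences *)

Section ChainSequences.
Variable R : realType.
Implicit Types (d g m M : nat -> R).

(** Since 1 - g_n never vanishes, d_(n+1) and g_n determine g_(n+1). *)
Lemma parameter_sequence_unique d g h : parameter_sequence d g ->
  parameter_sequence d h -> g 0%N = h 0%N -> g =1 h.
Proof.
move=> [/andP[_ g0] gP] [_ hP] gh0; elim=> [//|n IH].
have g1 : 1 - g n != 0.
  by case: n IH => [|n] _; rewrite subr_eq0 gt_eqF//; case: (gP n) => /andP[].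
have [_ dg] := gP n; have [_ dh] := hP n.
by apply: (mulfI g1); rewrite -dg dh IH.
Qed.

(** Partial sums of Wall's series. There are [n] terms, the first being the empty product 1, so
    [odds_sum g n.+1] is the K_n of the overview. *)
Definition odds_sum m n : R := \sum_(i < n) \prod_(j < i) (m j.+1 / (1 - m j.+1)).

Lemma param_odds_gt0 d m n : parameter_sequence d m -> 0 < m n.+1 / (1 - m n.+1).
Proof. by move=> [_ /(_ n)[/andP[m0 m1] _]]; rewrite divr_gt0// subr_gt0. Qed.

Lemma odds_sumS m n :
  odds_sum m n.+1 = odds_sum m n + \prod_(j < n) (m j.+1 / (1 - m j.+1)).
Proof. by rewrite /odds_sum big_ord_recr. Qed.

(* With g_n > m_n the ratio u_n = (1 - m_n) / (g_n - m_n) obeys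
   u_n = 1 + (m_{n+1} / (1 - m_{n+1})) u_{n+1}. *)
Lemma odds_sum_le d m g n : minimal_parameter_sequence d m ->
  parameter_sequence d g -> 0 < g 0%N -> odds_sum m n <= (g 0%N)^-1.
Proof.
move=> [mP m0] gP g0; have mlt1 j : m j < 1.
  by case: j => [|j]; [rewrite m0|case: mP => _ /(_ j)[/andP[]]].
have mgt0 j : 0 < m j.+1 by case: mP => _ /(_ j)[/andP[]].
have ggt0 j : 0 < g j.+1 by case: gP => _ /(_ j)[/andP[]].
have step j : (1 - g j) * g j.+1 = (1 - m j) * m j.+1.
  by case: gP => _ /(_ j)[_ <-]; case: mP => _ /(_ j)[_ <-].
(* A larger g_j makes 1 - g_j smaller, and the fixed product d_(j+1) then forces a larger
   g_(j+1). *)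
have mg j : m j < g j.
  elim: j => [|j IH]; first by rewrite m0.
  have : (1 - g j) * g j.+1 < (1 - m j) * g j.+1 by rewrite ltr_pM2r// ltrD2l ltrN2.
  by rewrite step ltr_pM2l// subr_gt0.
(* Unrolling the relation for u_n from u_0 = 1 / g_0 gives the partial sum plus a nonnegative
   remainder. *)
suff -> : (g 0%N)^-1 = odds_sum m n +
    (\prod_(j < n) (m j.+1 / (1 - m j.+1))) * ((1 - m n) / (g n - m n)).
  rewrite lerDl mulr_ge0//; last by rewrite ltW// divr_gt0// subr_gt0.
  by apply: prodr_ge0 => j _; rewrite ltW// (param_odds_gt0 _ mP).
elim: n => [|n IH].
  by rewrite /odds_sum !big_ord0 m0 !subr0 add0r mul1r div1r.
rewrite IH odds_sumS -addrA big_ord_recr/= -[X in X + _ * _ * _]mulr1 -mulrA -mulrDr.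
congr (_ + _ * _).
have := mg n; have := mg n.+1; have := mlt1 n.+1; have := step n.
move: (m n) (m n.+1) (g n) (g n.+1) => a b x y xy b1 byy ax.
have y0 : y - b != 0 by rewrite subr_eq0 gt_eqF.
have x0 : x - a != 0 by rewrite subr_eq0 gt_eqF.
have b0 : 1 - b != 0 by rewrite subr_eq0 gt_eqF.
apply: (mulIf x0); apply: (mulIf y0).
have -> : (1 - a) / (x - a) * (x - a) * (y - b) = (1 - a) * (y - b) by field.
have -> : (1 + b / (1 - b) * ((1 - b) / (y - b))) * (x - a) * (y - b) = y * (x - a).
  by field; rewrite b0 y0.
by nra.
Qed.

(** Converse of [odds_sum_le]: the normalized remainders u_n = (U - S_n) / P_n solve the same
    recursion with u_0 = U, and solving u_n = (1 - m_n) / (g_n - m_n) for g_n yields the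
    parameters. *)
Lemma parameter_of_odds_sum_le d m U : minimal_parameter_sequence d m ->
  (forall n, odds_sum m n <= U) ->
  exists2 g, parameter_sequence d g & g 0%N = U^-1.
Proof.
move=> [mP m0] SU; pose P n := \prod_(j < n) (m j.+1 / (1 - m j.+1)).
have mlt1 j : m j < 1.
  by case: j => [|j]; [rewrite m0|case: mP => _ /(_ j)[/andP[]]].
have mgt0 j : 0 < m j.+1 by case: mP => _ /(_ j)[/andP[]].
have PS n : odds_sum m n.+1 = odds_sum m n + P n by exact: odds_sumS.
have P0 n : 0 < P n by apply: prodr_gt0 => j _; exact: param_odds_gt0 mP.
(* The bound is taken at n + 2, not n + 1, to get a strict inequality: it makes u_n > 1, which is
   g_n < 1. *)
have PU n : P n < U - odds_sum m n.
  by have := SU n.+2; have := P0 n.+1; rewrite !PS; lra.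
pose u n := (U - odds_sum m n) / P n.
have u1 n : 1 < u n by rewrite ltr_pdivlMr// mul1r.
have uS n : u n = 1 + m n.+1 / (1 - m n.+1) * u n.+1.
  rewrite /u PS {3}/P big_ord_recr/= -/(P n); field.
  by rewrite subr_eq0 !gt_eqF ?mgt0 ?mlt1 ?P0.
exists (fun n => m n + (1 - m n) / u n); last first.
  by rewrite m0 add0r subr0 div1r /u /P /odds_sum !big_ord0 subr0 divr1.
have m_ge0 n : 0 <= m n by case: n => [|n]; rewrite ?m0// ltW.
have bnd n : m n < m n + (1 - m n) / u n < 1.
  have u0 : 0 < u n by rewrite (lt_trans _ (u1 n)).
  rewrite ltrDl divr_gt0 ?subr_gt0//= -ltrBrDl ltr_pdivrMr//.
  by rewrite ltr_pMr// subr_gt0.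
split.
  by have /andP[mg ->] := bnd 0%N; rewrite andbT (le_trans (m_ge0 0%N))// ltW.
move=> n; have /andP[mg g1] := bnd n.+1; split.
  by rewrite g1 andbT (lt_trans (mgt0 n)).
have -> : d n.+1 = (1 - m n) * m n.+1 by case: mP => _ /(_ n)[].
have := uS n; have := u1 n; have := u1 n.+1; have := mlt1 n.+1.
move: (u n) (u n.+1) (m n) (m n.+1) => x y a b b1 y1 x1 xE.
have y0 : y != 0 by lra.
have b0 : 1 - b != 0 by lra.
have x0 : x != 0 by lra.
have xE' : x * (1 - b) = (1 - b) + b * y by rewrite xE; field.
apply: (mulIf x0); apply: (mulIf y0).
have -> : (1 - (a + (1 - a) / x)) * (b + (1 - b) / y) * x * y =
   (1 - a) * (x - 1) * (b * y + (1 - b)) by field; rewrite x0 y0.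
have -> : (1 - a) * b * x * y = (1 - a) * x * (b * y) by ring.
have -> : b * y = x * (1 - b) - (1 - b) by rewrite xE' addrC addKr.
by ring.
Qed.

(** The least upper bound of the sums is 1 / t: a positive initial parameter s of [d] is followed by
    (1 - t) M_1 / (1 - s), which must not exceed M_1, so s is at most t. *)
Lemma odds_sum_sup d M m t : positive_chain_sequence (fun n => d n.+1) ->
  maximal_parameter_sequence (fun n => d n.+1) (fun n => M n.+1) ->
  0 < M 1%N -> 0 < t < 1 -> d 1%N = (1 - t) * M 1%N ->
  minimal_parameter_sequence d m ->
  (forall n, odds_sum m n <= t^-1) /\
  (forall U, (forall n, odds_sum m n <= U) -> t^-1 <= U).
Proof.
move=> [g0 g0P] Mmax M0 /andP[t0 t1] d1 mP; split; last first.
  move=> U SU; have U0 : 0 < U.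
    by rewrite (lt_le_trans _ (SU 1%N))// odds_sumS /odds_sum !big_ord0 add0r.
  have [g gP gE] := parameter_of_odds_sum_le mP SU.
  (* The shift of [g] is a parameter sequence of the shifted chain sequence. *)
  have gM : g 1%N <= M 1%N.
    rewrite Mmax; apply: sup_upper_bound.
      split; first by exists (g0 0%N); exists g0.
      by exists 1 => _ [h [/andP[_ /ltW h1] _] <-].
    exists (fun n => g n.+1) => //; split; last by move=> n; case: gP => _ /(_ n.+1).
    by case: gP => _ /(_ 0%N)[/andP[a b] _]; rewrite ltW.
  rewrite -[U]invrK lef_pV2 ?posrE ?invr_gt0// -gE.
  have [_ /(_ 0%N)[/andP[g1p _]]] := gP; rewrite d1 gE => dE.
  have : (1 - t) * g 1%N <= (1 - U^-1) * g 1%N.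
    by rewrite -dE ler_pM2l// subr_gt0.
  by rewrite ler_pM2r//; lra.
(* A sum S above 1 / t would bound all initial parameters of the shifted sequence by (1 - t) M_1 /
   (1 - 1 / S), which is less than their supremum M_1. *)
move=> n; rewrite leNgt; apply/negP => tS.
set S := odds_sum m n in tS *; have S0 : 0 < S by rewrite (lt_trans _ tS)// invr_gt0.
have St : S^-1 < t by rewrite -[t]invrK ltf_pV2 ?posrE ?invr_gt0.
have : M 1%N <= (1 - t) * M 1%N / (1 - S^-1).
  rewrite [X in X <= _]Mmax; apply: ge_sup; first by exists (g0 0%N); exists g0.
  move=> _ [g gP <-]; rewrite ler_pdivlMr; last by lra.
  have [gle|gt] := leP (g 0%N) ((1 - t) * M 1%N).
    apply: le_trans gle; rewrite ler_piMr//; first by case: gP => /andP[].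
    by rewrite gerBl invr_ge0 ltW.
  have gpos : 0 < g 0%N by rewrite (lt_trans _ gt)// mulr_gt0// subr_gt0.
  (* This [s] solves (1 - s) g_0 = d_1, so it can be prepended to [g]; it is positive because g_0 >
     d_1. *)
  pose s := 1 - (1 - t) * M 1%N / g 0%N.
  have s0 : 0 < s by rewrite subr_gt0 ltr_pdivrMr// mul1r.
  have hP : parameter_sequence d (fun n => if n is p.+1 then g p else s).
    split; first by rewrite ltW//= gtrBl divr_gt0// mulr_gt0// subr_gt0.
    case: gP => /andP[_ g1] gP [|p]; last by exact: gP.
    by rewrite gpos g1 d1 /s; split=> //; field; rewrite gt_eqF.
  have := odds_sum_le n mP hP s0; rewrite -/S => Ss.
  have sS : s <= S^-1 by rewrite -[s]invrK lef_pV2 ?posrE ?invr_gt0.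
  have -> : (1 - t) * M 1%N = g 0%N * (1 - s) by rewrite /s; field; rewrite gt_eqF.
  by rewrite ler_pM2l//; lra.
rewrite ler_pdivlMr; last by lra.
by rewrite mulrC ler_pM2r//; lra.
Qed.

End ChainSequences.

(** * Szego recurrence *)

Section Szego.
Context {C : numClosedFieldType}.
Implicit Types (p q : {poly C}) (ip : {poly C} -> {poly C} -> C).

(** Szego's reversed polynomial, relative to the formal degree [n] rather than the actual degree of
    [p]. *)
Definition reverse_poly (n : nat) p : {poly C} :=
  \poly_(i < n.+1) (p`_(n - i))^*.

(** The algebraic properties of the inner product of a measure on the circle: multiplication by z is
    isometric and reversal is antiunitary. Positivity will come from |alpha_n| < 1. *)
Record circle_form ip : Prop := CircleForm {
  form_addr : forall p q r, ip p (q + r) = ip p q + ip p r;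
  form_scaler : forall a p q, ip p (a *: q) = a * ip p q;
  form_conj : forall p q, ip q p = (ip p q)^*;
  form_mulX : forall p q, ip ('X * p) ('X * q) = ip p q;
  form_reverse : forall n p q, (size p <= n.+1)%N -> (size q <= n.+1)%N ->
    ip (reverse_poly n p) (reverse_poly n q) = ip q p;
  form_one : ip 1 1 = 1 }.

Definition orthogonal_polynomials ip (Phi : nat -> {poly C}) : Prop :=
  forall n, [/\ Phi n \is monic, size (Phi n) = n.+1 &
    forall j, (j < n)%N -> ip 'X^j (Phi n) = 0].

Lemma size_reverse_poly n p : (size (reverse_poly n p) <= n.+1)%N.
Proof. exact: size_poly. Qed.

Lemma reverse_polyXn n j : (j <= n)%N -> reverse_poly n 'X^j = 'X^(n - j).
Proof.
move=> jn; apply/polyP => i; rewrite coef_poly !coefXn ltnS.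
case: leqP => [ni|ni].
  have -> : (i == n - j)%N = (n - i == j)%N by lia.
  by rewrite rmorph_nat.
by have -> : (i == n - j)%N = false by lia.
Qed.

Lemma horner1_reverse_poly n p : (size p <= n.+1)%N ->
  (reverse_poly n p).[1] = (p.[1])^*.
Proof.
move=> pn; rewrite horner_poly (horner_coef_wide _ pn) rmorph_sum/=.
rewrite (reindex_inj rev_ord_inj)/=; apply: eq_bigr => i _.
by rewrite !expr1n !mulr1 subSS subKn// -ltnS.
Qed.

(** * Verblunsky coefficients built from parameters and phases *)

Section Phase.
Variables (w g tau alpha : nat -> C).
Hypothesis wE : forall n, w n + (w n)^* = 2.
Hypothesis g01 : forall n, 0 < g n < 1.
Hypothesis tau0 : tau 0%N = 1.
Hypothesis tauS : forall n, tau n.+1 = (w n)^* / w n * tau n.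
Hypothesis alphaE :
  forall n, alpha n = (tau n.+1)^* * (((w n)^* - 2 * g n) / w n).

Lemma phase_denominator_neq0 j : w j != 0.
Proof.
by apply/eqP => w0; move/eqP: (wE j); rewrite w0 conjC0 addr0 eq_sym pnatr_eq0.
Qed.

Lemma tau_unimodular j : tau j * (tau j)^* = 1.
Proof.
elim: j => [|j IH]; first by rewrite tau0 conjC1 mulr1.
rewrite tauS !rmorphM/= conjCK fmorphV/= -[RHS]IH; field.
by rewrite conjC_eq0 !phase_denominator_neq0.
Qed.

(** Conjugation brings in tau_(j+1), whose factor conj(w_j) cancels the conjugated denominator and
    leaves tau_j. *)
Lemma conj_alpha j : (alpha j)^* = tau j * ((w j - 2 * g j) / w j).
Proof.
have gJ : (g j)^* = g j.
  by apply: CrealP; apply: ger0_real; case/andP: (g01 j) => /ltW.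
rewrite alphaE !rmorphM/= conjCK tauS fmorphV/= rmorphB/= conjCK rmorphM/= gJ.
by rewrite conjC_nat; field; rewrite conjC_eq0 !phase_denominator_neq0.
Qed.

(** The numerator comes out as 2 (w + conj w) g - 4 g^2, and w + conj w = 2. *)
Lemma defect_alpha n : 1 - `|alpha n| ^+ 2 = 4 * (g n * (1 - g n)) / `|w n| ^+ 2.
Proof.
rewrite normCK conj_alpha alphaE tauS !rmorphM/= fmorphV/= conjCK normCK.
have -> : 4 * (g n * (1 - g n)) = 2 * (w n + (w n)^*) * g n - 4 * g n ^+ 2.
  by rewrite wE; ring.
have t0 : tau n != 0.
  by apply/eqP => t0; move/eqP: (tau_unimodular n); rewrite t0 mul0r eq_sym oner_eq0.
have -> : (tau n)^* = (tau n)^-1 by apply: (mulfI t0); rewrite tau_unimodular divff.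
by field; rewrite conjC_eq0 !phase_denominator_neq0 t0.
Qed.

Lemma alpha_lt1 n : `|alpha n| < 1.
Proof.
rewrite -(@expr_lt1 _ 2)// -subr_gt0 defect_alpha.
have [g0 g1] := andP (g01 n).
by rewrite divr_gt0 ?exprn_gt0 ?normr_gt0 ?phase_denominator_neq0// !mulr_gt0// subr_gt0.
Qed.

End Phase.

(** * Orthogonal polynomials of a form and their Christoffel sums *)

Section Form.
Variables (ip : {poly C} -> {poly C} -> C) (ipF : circle_form ip).

Lemma form_addl p q r : ip (p + q) r = ip p r + ip q r.
Proof. by rewrite !(form_conj ipF r) form_addr// rmorphD. Qed.

Lemma form_scalel a p q : ip (a *: p) q = a^* * ip p q.
Proof. by rewrite !(form_conj ipF q) form_scaler// rmorphM. Qed.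

Lemma form0r p : ip p 0 = 0.
Proof. by rewrite -(scale0r 0) form_scaler// mul0r. Qed.

Lemma form_suml (I : Type) (s : seq I) (F : I -> {poly C}) p :
  ip (\sum_(i <- s) F i) p = \sum_(i <- s) ip (F i) p.
Proof.
elim: s => [|i s IH]; first by rewrite !big_nil (form_conj ipF p) form0r conjC0.
by rewrite !big_cons form_addl IH.
Qed.

Lemma form_eq0 n p q : (size p <= n)%N ->
  (forall j, (j < n)%N -> ip 'X^j q = 0) -> ip p q = 0.
Proof.
move=> pn qn; rewrite -[p]coefK poly_def form_suml big1// => i _.
by rewrite form_scalel qn ?mulr0// (leq_trans _ pn).
Qed.

Variables (Phi : nat -> {poly C}) (PhiO : orthogonal_polynomials ip Phi).

Let alpha n : C := - ((Phi n.+1).[0])^*.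

Lemma size_sub_lead n p : (size p <= n.+1)%N ->
  (size (p - p`_n *: Phi n)%R <= n)%N.
Proof.
move=> pn; have [/monicP Pm Ps _] := PhiO n; apply/leq_sizeP => j nj; rewrite coefB coefZ.
have [->|njN] := eqVneq j n.
  by move: Pm; rewrite /lead_coef Ps/= => ->; rewrite mulr1 subrr.
have {njN}nj : (n < j)%N by rewrite ltn_neqAle eq_sym njN.
by rewrite (nth_default 0 (leq_trans pn nj)) [(Phi n)`_j]nth_default ?Ps// mulr0 subrr.
Qed.

(** Removing the leading multiple of the top [Phi] lowers the degree and keeps the orthogonality, so
    by induction [p] is that multiple, and pairing with [Phi] kills it. Only norms below [n] are
    assumed nonzero, so that the lemma can serve in the induction that computes the norms. *)
Lemma form_nondegenerate n p :
  (forall j, (j < n)%N -> ip (Phi j) (Phi j) != 0) -> (size p <= n)%N ->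
  (forall j, (j < n)%N -> ip 'X^j p = 0) -> p = 0.
Proof.
elim: n p => [|n IH] p Pn0 pn pO; first by apply/eqP; rewrite -size_poly_leq0.
have [_ Ps PO] := PhiO n.
have pE : p = p`_n *: Phi n.
  apply/eqP; rewrite -subr_eq0; apply/eqP/IH; first by move=> j jn; exact/Pn0/ltnW.
    exact: size_sub_lead.
  by move=> j jn; rewrite -scaleNr form_addr// form_scaler// pO ?PO ?mulr0 ?addr0// ltnW.
have : ip (Phi n) p = 0 by apply: (@form_eq0 n.+1) => //; rewrite Ps.
rewrite pE form_scaler// => /eqP; rewrite mulf_eq0 (negPf (Pn0 _ _))// orbF.
by move=> /eqP->; rewrite scale0r.
Qed.

(** Reversal sends X^j to X^(n-j), and n - j < n. *)
Lemma form_reverse_eq0 n j : (0 < j <= n)%N ->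
  ip 'X^j (reverse_poly n (Phi n)) = 0.
Proof.
have [_ Ps PO] := PhiO n.
move=> /andP[j0 jn]; have -> : 'X^j = reverse_poly n 'X^(n - j) :> {poly C}.
  by rewrite reverse_polyXn ?leq_subr// subKn.
rewrite form_reverse ?Ps ?size_polyXn ?ltnS ?leq_subr//.
rewrite (form_conj ipF 'X^(n - j)) PO ?conjC0//.
by rewrite -subn_gt0 subKn.
Qed.

(** The difference [q] of the two sides has no constant term, by the choice of [alpha], and no term
    of degree n + 1, both leading coefficients being 1. Hence q = X r with r of degree below n, and
    r is orthogonal to every X^j with j < n. *)
Lemma szego_recurrence_step n :
  (forall j, (j < n)%N -> ip (Phi j) (Phi j) != 0) ->
  Phi n.+1 = 'X * Phi n - (alpha n)^* *: reverse_poly n (Phi n).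
Proof.
move=> Pn0; have [/monicP Pm Ps PO] := PhiO n.
have [/monicP Pm1 Ps1 PO1] := PhiO n.+1.
set q := Phi n.+1 - 'X * Phi n + (alpha n)^* *: reverse_poly n (Phi n).
suff q0 : q = 0 by move/eqP: q0; rewrite /q -addrA addr_eq0 opprD opprK => /eqP.
have coefq0 : q`_0 = 0.
  rewrite /q coefD coefB coefXM/= subr0 coefZ coef_poly/= subn0.
  move: Pm; rewrite /lead_coef Ps/= => ->; rewrite conjC1 mulr1.
  by rewrite /alpha horner_coef0 rmorphN/= conjCK subrr.
have sq : (size q <= n.+1)%N.
  apply/leq_sizeP => j nj; rewrite /q coefD coefB coefXM coefZ.
  rewrite (nth_default 0 (leq_trans (size_reverse_poly n (Phi n)) nj)) mulr0 addr0.
  move: nj; rewrite leq_eqVlt => /predU1P[<-|nj].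
    by move: Pm Pm1; rewrite /lead_coef Ps Ps1/= => -> ->; rewrite subrr.
  rewrite gtn_eqF ?(leq_trans _ nj)// !nth_default ?subrr ?Ps ?Ps1//.
  by rewrite -ltnS prednK ?(leq_trans _ nj).
have qE : q = 'X * drop_poly 1 q.
  rewrite -[LHS](poly_take_drop 1) expr1 mulrC; suff -> : take_poly 1 q = 0 by rewrite add0r.
  by apply/polyP => -[|i]; rewrite coef_take_poly coef0.
suff -> : q = 'X * 0 by rewrite mulr0.
rewrite qE; congr (_ * _); apply: (@form_nondegenerate n) => //.
  by rewrite size_drop_poly leq_subLR add1n.
(* Multiplying by X moves the exponents to 1, ..., n, where each of the three terms of [q] pairs to
   0. *)
move=> j jn; rewrite -form_mulX// -qE /q -exprS.
rewrite -scaleN1r !form_addr// !form_scaler// PO1 ?ltnS// form_reverse_eq0 ?jn//.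
by rewrite exprS form_mulX// PO// !mulr0 !addr0.
Qed.

(** Pythagoras for X Phi_n = Phi_(n+1) + conj(alpha_n) Psi: the summands are orthogonal, and X Phi_n
    and the reversed polynomial Psi both have the norm of Phi_n. *)
Lemma form_szego_step n :
  (forall j, (j < n)%N -> ip (Phi j) (Phi j) != 0) ->
  ip (Phi n.+1) (Phi n.+1) = (1 - `|alpha n| ^+ 2) * ip (Phi n) (Phi n).
Proof.
move=> Pn0; have [_ Ps PO] := PhiO n; have [_ Ps1 PO1] := PhiO n.+1.
set Psi := reverse_poly n (Phi n).
have Psi1 : ip Psi (Phi n.+1) = 0 by apply: form_eq0 PO1; exact: size_reverse_poly.
have XP : 'X * Phi n = Phi n.+1 + (alpha n)^* *: Psi.
  by rewrite szego_recurrence_step// subrK.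
rewrite mulrBl mul1r -{1}(form_mulX ipF (Phi n)) XP form_addl// !form_addr// !form_scalel.
rewrite !form_scaler// Psi1 (form_conj ipF Psi) Psi1 conjC0 conjCK !mulr0 addr0 add0r.
by rewrite form_reverse ?Ps// mulrA -normCK; ring.
Qed.

Hypothesis alpha_lt1 : forall n, `|alpha n| < 1.

Lemma orthogonal_polynomial0 : Phi 0%N = 1.
Proof.
have [Pm Ps _] := PhiO 0; have /size_poly1P[a _ PE] : size (Phi 0) == 1 by rewrite Ps.
by move/monicP: Pm; rewrite PE lead_coefC => ->.
Qed.

Lemma form_szego n : ip (Phi n) (Phi n) = \prod_(j < n) (1 - `|alpha j| ^+ 2).
Proof.
elim/ltn_ind: n => -[|n] IH.
  by rewrite big_ord0 orthogonal_polynomial0 form_one.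
rewrite form_szego_step; first by rewrite IH// big_ord_recr mulrC.
move=> j jn; rewrite IH ?(ltn_trans jn)//; apply/prodf_neq0 => i _.
by rewrite subr_eq0 gt_eqF// expr_lt1.
Qed.

Lemma form_Phi_gt0 n : 0 < ip (Phi n) (Phi n).
Proof.
by rewrite form_szego; apply: prodr_gt0 => i _; rewrite subr_gt0 expr_lt1.
Qed.

Lemma szego_recurrence n :
  Phi n.+1 = 'X * Phi n - (alpha n)^* *: reverse_poly n (Phi n).
Proof. by apply: szego_recurrence_step => j _; rewrite gt_eqF ?form_Phi_gt0. Qed.

Definition christoffel_sum n : C :=
  \sum_(j < n.+1) `|(Phi j).[1]| ^+ 2 / ip (Phi j) (Phi j).

(** Cauchy-Schwarz in the orthogonal basis, by splitting off the multiple of the top [Phi].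
    Positivity of the form is proved along with it, since the induction needs it. *)
Lemma eval1_le_christoffel n p : (size p <= n)%N ->
  0 <= ip p p /\ `|p.[1]| ^+ 2 <=
    (\sum_(j < n) `|(Phi j).[1]| ^+ 2 / ip (Phi j) (Phi j)) * ip p p.
Proof.
elim: n p => [|n IH] p pn.
  move: pn; rewrite size_poly_leq0 => /eqP->; rewrite form0r horner0 normr0.
  by rewrite expr0n mulr0 lexx.
have [_ Ps PO] := PhiO n.
have pE : p = (p - p`_n *: Phi n) + p`_n *: Phi n by rewrite subrK.
move: pE (size_sub_lead pn); move: (p`_n) => a; move: (p - _)%R => q pE qn.
have [q0 qle] := IH q qn.
have qP : ip q (Phi n) = 0 by exact: form_eq0 PO.
have Pq : ip (Phi n) q = 0 by rewrite (form_conj ipF q) qP conjC0.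
have k0 := form_Phi_gt0 n; set k := ip (Phi n) (Phi n) in k0 *.
have ppE : ip p p = ip q q + `|a| ^+ 2 * k.
  rewrite pE form_addl !form_addr// !form_scalel !form_scaler// qP Pq !mulr0.
  by rewrite addr0 add0r mulrA normCK mulrC [_ * a^*]mulrC mulrC.
rewrite ppE; split; first by rewrite addr_ge0// mulr_ge0 ?exprn_ge0// ltW.
rewrite big_ord_recr/=; move: qle.
set K := \sum_(j < n) _; set x := ip q q in q0 *.
have K0 : 0 <= K.
  by apply: sumr_ge0 => j _; rewrite divr_ge0 ?exprn_ge0// ltW ?form_Phi_gt0.
move=> qle; rewrite [p in `|p.[1]|]pE hornerD hornerZ.
set u := q.[1] in qle *; set v := (Phi n).[1].
have -> : (K + `|v| ^+ 2 / k) * (x + `|a| ^+ 2 * k) =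
    K * x + (K * (`|a| ^+ 2 * k) + x * (`|v| ^+ 2 / k)) + `|a| ^+ 2 * `|v| ^+ 2.
  by field; rewrite gt_eqF.
set y1 := K * (_ * k); set y2 := x * (_ / k).
have y10 : 0 <= y1 by rewrite !mulr_ge0 ?exprn_ge0// ltW.
have y20 : 0 <= y2 by rewrite !mulr_ge0 ?exprn_ge0// invr_ge0 ltW.
(* The cross term, by the inequality of arithmetic and geometric means: [qle] bounds its square by 4
   y1 y2. *)
have av : 2 * (`|u| * (`|a| * `|v|)) <= y1 + y2.
  rewrite -(@ler_pXn2r _ 2)//; [|by rewrite nnegrE !mulr_ge0|by rewrite nnegrE addr_ge0].
  have le1 : (2 * (`|u| * (`|a| * `|v|))) ^+ 2 <= 4 * (y1 * y2).
    have -> : 4 * (y1 * y2) = 4 * (K * x * (`|a| ^+ 2 * `|v| ^+ 2)).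
      by rewrite /y1 /y2; field; rewrite gt_eqF.
    have -> : (2 * (`|u| * (`|a| * `|v|))) ^+ 2 = 4 * (`|u| ^+ 2 * (`|a| ^+ 2 * `|v| ^+ 2)).
      by ring.
    by rewrite ler_pM2l// ler_wpM2r// mulr_ge0 ?exprn_ge0.
  apply: le_trans le1 _; rewrite -subr_ge0.
  have -> : (y1 + y2) ^+ 2 - 4 * (y1 * y2) = (y1 - y2) ^+ 2 by ring.
  by rewrite real_exprn_even_ge0// rpredB// ger0_real.
apply: (@le_trans _ _ ((`|u| + `|a| * `|v|) ^+ 2)).
  by rewrite (@ler_pXn2r _ 2)// ?nnegrE ?addr_ge0 ?mulr_ge0// -normrM ler_normD.
have -> : (`|u| + `|a| * `|v|) ^+ 2 =
    `|u| ^+ 2 + 2 * (`|u| * (`|a| * `|v|)) + `|a| ^+ 2 * `|v| ^+ 2 by ring.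
by rewrite lerD2r lerD.
Qed.

(** The witness is the reproducing kernel at 1, the sum of conj(Phi_j(1)) / ||Phi_j||^2 times Phi_j.
    The size bound carried in the induction makes each new Phi_j orthogonal to the previous sum. *)
Lemma christoffel_extremal n : exists q, q.[1] = christoffel_sum n /\
  ip q q = christoffel_sum n.
Proof.
rewrite /christoffel_sum.
suff [q [_ q1 qq]] : exists q, [/\ (size q <= n.+1)%N,
    q.[1] = \sum_(j < n.+1) `|(Phi j).[1]| ^+ 2 / ip (Phi j) (Phi j) &
    ip q q = \sum_(j < n.+1) `|(Phi j).[1]| ^+ 2 / ip (Phi j) (Phi j)].
  by exists q.
elim: n.+1 => [|{}n [q [qn q1 qq]]].
  by exists 0; rewrite size_poly0 horner0 form0r !big_ord0.
have [_ Ps PO] := PhiO n; have k0 := form_Phi_gt0 n.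
set b := ((Phi n).[1])^* / ip (Phi n) (Phi n).
have qP : ip q (Phi n) = 0 by exact: form_eq0 PO.
have Pq : ip (Phi n) q = 0 by rewrite (form_conj ipF q) qP conjC0.
exists (q + b *: Phi n); split.
- rewrite (leq_trans (size_polyD _ _))// geq_max (leq_trans qn)//=.
  by rewrite (leq_trans (size_scale_leq _ _))// Ps.
- by rewrite hornerD hornerZ q1 big_ord_recr/= normCK /b; congr (_ + _); ring.
- rewrite form_addl !form_addr// !form_scalel !form_scaler// qP Pq !mulr0.
  rewrite addr0 add0r qq big_ord_recr/= normCK /b; congr (_ + _).
  rewrite rmorphM/= conjCK fmorphV/= -[(ip (Phi n) (Phi n))^*](form_conj ipF).
  by field; rewrite gt_eqF.
Qed.

(* The phase of Phi_n(1) is carried by tau, so that the recurrence at 1 reads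
   Phi_{n+1}(1) = (2 g_n / w_n) Phi_n(1). *)
Lemma christoffel_term (w g tau : nat -> C) :
  (forall n, w n + (w n)^* = 2) -> (forall n, 0 < g n < 1) ->
  tau 0%N = 1 -> (forall n, tau n.+1 = (w n)^* / w n * tau n) ->
  (forall n, alpha n = (tau n.+1)^* * (((w n)^* - 2 * g n) / w n)) ->
  forall n, `|(Phi n).[1]| ^+ 2 / ip (Phi n) (Phi n) =
    \prod_(j < n) (g j / (1 - g j)).
Proof.
move=> wE g01 tau0 tauS alphaE n.
have w0 j : w j != 0 by exact: phase_denominator_neq0.
have wc0 j : (w j)^* != 0 by rewrite conjC_eq0.
have gJ j : (g j)^* = g j.
  by apply: CrealP; apply: ger0_real; case/andP: (g01 j) => /ltW.
have tau1 := tau_unimodular wE tau0 tauS.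
have alphaJ := conj_alpha wE g01 tauS alphaE.
(* Under the phase relation the reversed polynomial takes the value conj(tau_j) Phi_j(1) at 1; the
   phase cancels the tau_j of conj(alpha_j), leaving the factor 1 - (w - 2 g) / w. *)
have step j : ((Phi j).[1])^* = (tau j)^* * (Phi j).[1] ->
    (Phi j.+1).[1] = 2 * g j / w j * (Phi j).[1].
  have [_ Ps _] := PhiO j.
  move=> rj; rewrite szego_recurrence hornerD hornerN hornerZ hornerM hornerX mul1r.
  rewrite horner1_reverse_poly ?Ps// rj alphaJ mulrACA tau1; field.
  exact: w0.
have phase j : ((Phi j).[1])^* = (tau j)^* * (Phi j).[1].
  elim: j => [|j IH]; first by rewrite orthogonal_polynomial0 hornerC tau0 conjC1 mulr1.
  rewrite step// tauS !rmorphM/= !fmorphV/= conjCK conjC_nat gJ IH; field.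
  by rewrite w0 wc0.
elim: n => [|n IH]; last first.
  have g0 : g n != 0 by case/andP: (g01 n) => /gt_eqF->.
  have g1 : 1 - g n != 0 by rewrite subr_eq0 gt_eqF//; case/andP: (g01 n).
  (* The ratio of consecutive terms is |2 g / w|^2 over the defect 4 g (1 - g) / |w|^2, which is g /
     (1 - g). *)
  rewrite form_szego_step; last by move=> j _; rewrite gt_eqF ?form_Phi_gt0.
  rewrite big_ord_recr/= -IH (defect_alpha wE g01 tau0 tauS alphaE) step// !normrM normfV normr_nat.
  have [g_gt0 _] := andP (g01 n); rewrite (gtr0_norm g_gt0).
  by field; rewrite normr_eq0 w0 g0 g1 gt_eqF ?form_Phi_gt0.
by rewrite form_szego !big_ord0 orthogonal_polynomial0 hornerC normr1 expr1n invr1 mulr1.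
Qed.

End Form.
End Szego.

(** * Integration over the circle *)

Section CircleIntegral.
Variable R : realType.
Local Notation Re := (@complex.Re R).
Local Notation Im := (@complex.Im R).
Local Notation circle := (@unit_circle R).

(** Preimages of open intervals are open, and intervals generate the Borel sets of the line. *)
Lemma measurable_lipschitz_real (f : R[i] -> R) :
  (forall y z, `|f y - f z|%:C <= `|y - z|) ->
  measurable_fun [set: borelC R] (f : borelC R -> R).
Proof.
move=> flip; apply: (measurability _ (RGenOpens.measurableE R)).
move=> _ [_ [a [b ->] <-]]; rewrite setTI; apply: sub_sigma_algebra.
rewrite /= openE => z /= zab.
have /nbhs_ballP[e /= e0 eab] : nbhs (f z) `]a, b[%classic.
  by apply: open_nbhs_nbhs; split=> //; exact: interval_open.
apply/nbhs_ballP; exists e%:C; first by rewrite /= ltcR.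
move=> y; rewrite -ball_normE /= => zy; apply: eab; rewrite -ball_normE/=.
by rewrite -ltcR (le_lt_trans _ zy).
Qed.

Lemma measurable_Re : measurable_fun [set: borelC R] (Re : borelC R -> R).
Proof.
apply: measurable_lipschitz_real => y z.
by rewrite (_ : Re y - Re z = Re (y - z)) ?normc_ge_Re// raddfB.
Qed.

Lemma measurable_Im : measurable_fun [set: borelC R] (Im : borelC R -> R).
Proof.
apply: measurable_lipschitz_real => y z.
have -> : Im y - Im z = Re ((y - z) * - 'i%C).
  by case: y z => [a b] [c d] /=; simpc.
by apply: le_trans (normc_ge_Re _) _; rewrite normrM normrN complexiE normCi mulr1.
Qed.

Lemma measurable_circle : measurable circle.
Proof.
have -> : circle = (fun z : borelC R => Re z ^+ 2 + Im z ^+ 2) @^-1` [set 1].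
  apply/seteqP; split=> z /=; rewrite /unit_circle /=.
    move=> z1; apply: (@complexI R); rewrite add_Re2_Im2.
    by rewrite (_ : `|z| = 1)// expr1n.
  move=> zE; have := add_Re2_Im2 z; rewrite zE => /esym/eqP.
  by rewrite sqrp_eq1// => /eqP.
rewrite -[X in measurable X]setTI.
have mf : measurable_fun [set: borelC R] (fun z : borelC R => Re z ^+ 2 + Im z ^+ 2).
  by apply: measurable_funD; apply: measurable_funX; [exact: measurable_Re|exact: measurable_Im].
by apply: mf.
Qed.

(* [measurable] unfolds to a product, whose arguments would become implicit. *)
Arguments measurable_circle : clear implicits.

Lemma measurable_one : measurable [set (1 : R[i]) : borelC R].
Proof.
have -> : [set (1 : R[i]) : borelC R] =
    ((Re : borelC R -> R) @^-1` [set 1]) `&` ((Im : borelC R -> R) @^-1` [set 0]).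
  apply/seteqP; split=> [z /= ->//|z /= [z1 z0]].
  by apply/eqP; rewrite eq_complex /= z1 z0 !eqxx.
apply: measurableI; rewrite -[X in measurable X]setTI.
  by apply: measurable_Re.
by apply: measurable_Im.
Qed.

Arguments measurable_one : clear implicits.

Lemma circle_conj (z : R[i]) : circle z -> z^* * z = 1.
Proof. by rewrite /unit_circle/= mulrC -normCK => ->; rewrite expr1n. Qed.

(** Boundedness is asked on the circle only, since polynomials are unbounded on the plane. *)
Definition admissible (f : R[i] -> R[i]) : Prop :=
  [/\ measurable_fun [set: borelC R] (Re \o f : borelC R -> R),
      measurable_fun [set: borelC R] (Im \o f : borelC R -> R) &
      exists B : R[i], forall z, circle z -> `|f z| <= B].

Lemma admissible_cst c : admissible (fun=> c).
Proof. by split; [exact: measurable_cst|exact: measurable_cst|exists `|c|]. Qed.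

Lemma admissible_id : admissible id.
Proof.
split; [exact: measurable_Re|exact: measurable_Im|exists 1 => z].
by rewrite /unit_circle/= => ->.
Qed.

Lemma admissible_conj f : admissible f -> admissible (fun z => (f z)^*).
Proof.
move=> [mr mi [B fB]]; split.
- rewrite (_ : _ \o _ = Re \o f)//; apply/funext => z /=.
  by case: (f z).
- rewrite (_ : _ \o _ = (fun z => - (Im (f z))))//; first exact: measurableT_comp.
  by apply/funext => z /=; case: (f z).
- by exists B => z /fB; rewrite norm_conjC.
Qed.

Lemma admissibleD f g : admissible f -> admissible g ->
  admissible (fun z => f z + g z).
Proof.
move=> [mr mi [B fB]] [mr' mi' [B' gB]]; split.
- rewrite (_ : _ \o _ = (Re \o f) \+ (Re \o g)); first exact: measurable_funD.
  by apply/funext => z /=; case: (f z) (g z) => [a b] [c d].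
- rewrite (_ : _ \o _ = (Im \o f) \+ (Im \o g)); first exact: measurable_funD.
  by apply/funext => z /=; case: (f z) (g z) => [a b] [c d].
- by exists (B + B') => z cz; rewrite (le_trans (ler_normD _ _))// lerD ?fB ?gB.
Qed.

Lemma admissibleM f g : admissible f -> admissible g ->
  admissible (fun z => f z * g z).
Proof.
move=> [mr mi [B fB]] [mr' mi' [B' gB]]; split.
- rewrite (_ : _ \o _ = ((Re \o f) \* (Re \o g)) \- ((Im \o f) \* (Im \o g))).
    by apply: measurable_funB; exact: measurable_funM.
  by apply/funext => z /=; case: (f z) (g z) => [a b] [c d].
- rewrite (_ : _ \o _ = ((Re \o f) \* (Im \o g)) \+ ((Im \o f) \* (Re \o g))).
    by apply: measurable_funD; exact: measurable_funM.
  by apply/funext => z /=; case: (f z) (g z) => [a b] [c d].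
- by exists (B * B') => z cz; rewrite normrM ler_pM ?fB ?gB.
Qed.

Lemma admissible_horner (p : {poly R[i]}) : admissible (horner p).
Proof.
elim/poly_ind: p => [|p c IH].
  by rewrite (_ : horner 0 = fun=> 0); [exact: admissible_cst|apply/funext => z; rewrite horner0].
rewrite (_ : horner _ = fun z => p.[z] * z + c); last first.
  by apply/funext => z; rewrite hornerMXaddC.
by apply: admissibleD (admissible_cst c); exact: admissibleM admissible_id.
Qed.

Variables (mu : probability (borelC R) R) (muC : circle_probability mu).

Lemma admissible_integrable f : admissible f ->
  mu.-integrable circle (fun z => (Re (f z))%:E) /\
  mu.-integrable circle (fun z => (Im (f z))%:E).
Proof.
move=> [mr mi [B fB]].
have finC : (mu circle < +oo)%E by rewrite muC ltry.
have mC := measurable_circle.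
split; apply: (measurable_bounded_integrable mC finC).
- exact: measurable_funTS.
- exists (Re B); split; first exact: num_real.
  move=> M BM z cz; apply: (le_trans _ (ltW BM)).
  by have := le_trans (normc_ge_Re (f z)) (fB z cz); rewrite lecE /= => /andP[].
- exact: measurable_funTS.
- exists (Re B); split; first exact: num_real.
  move=> M BM z cz; apply: (le_trans _ (ltW BM)).
  have h : `|Im (f z)|%:C <= `|f z|.
    have -> : Im (f z) = Re (f z * - 'i%C) by case: (f z) => a b /=; simpc.
    by apply: le_trans (normc_ge_Re _) _; rewrite normrM normrN complexiE normCi mulr1.
  by have := le_trans h (fB z cz); rewrite lecE /= => /andP[].
Qed.

(** The complement of the circle is a null set. On the circle itself admissible functions are
    bounded, hence integrable. *)
Lemma Rintegral_circle (f : borelC R -> R) : measurable_fun setT f ->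
  Rintegral mu setT f = Rintegral mu circle f.
Proof.
move=> mf; rewrite [RHS]Rintegral_mkcond; congr fine.
apply: ae_eq_integral => //.
- exact/measurable_EFinP.
- apply/measurable_EFinP/(measurable_restrictT _ _).1; last exact: measurable_funTS.
  exact: measurable_circle.
- exists (~` circle); split; first by apply: measurableC; exact: measurable_circle.
    by have := probability_setC mu measurable_circle; rewrite muC subee.
  move=> z /= nz cz; apply: nz => _; rewrite /= patchE mem_set//.
Qed.

Lemma CintegralE f : admissible f -> Cintegral mu f =
  Rintegral mu circle (fun z => Re (f z)) +i* Rintegral mu circle (fun z => Im (f z)).
Proof. by move=> [mr mi _]; rewrite /Cintegral !Rintegral_circle. Qed.

Lemma eq_Cintegral f g : admissible f -> admissible g ->
  (forall z, circle z -> f z = g z) -> Cintegral mu f = Cintegral mu g.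
Proof.
move=> fA gA fg; rewrite !CintegralE//.
by congr Complex; apply: eq_Rintegral => z; rewrite inE => cz; rewrite fg.
Qed.

Lemma CintegralD f g : admissible f -> admissible g ->
  Cintegral mu (fun z => f z + g z) = Cintegral mu f + Cintegral mu g.
Proof.
move=> fA gA; have [fr fi] := admissible_integrable fA.
have [gr gi] := admissible_integrable gA.
rewrite !CintegralE//; last exact: admissibleD.
rewrite -[RHS]/(Complex _ _) -!RintegralD//; do ?exact: measurable_circle.
by congr Complex; apply: eq_Rintegral => z _; case: (f z) (g z) => [a b] [c d].
Qed.

Lemma CintegralZ a f : admissible f ->
  Cintegral mu (fun z => a * f z) = a * Cintegral mu f.
Proof.
move=> fA; have [fr fi] := admissible_integrable fA.
have mC := measurable_circle.
rewrite !CintegralE//; last exact: admissibleM (admissible_cst a) fA.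
case: a => a b; rewrite -[RHS]/(Complex _ _) -!RintegralZl//.
have iZ r (h : borelC R -> R) : mu.-integrable circle (EFin \o h) ->
    mu.-integrable circle (EFin \o (fun z => r * h z)).
  by move=> /(integrableZl mC r).
rewrite -RintegralB -?RintegralD//; [|exact: iZ..].
by congr Complex; apply: eq_Rintegral => z _; case: (f z).
Qed.

Lemma Cintegral_conj f : admissible f ->
  Cintegral mu (fun z => (f z)^*) = (Cintegral mu f)^*.
Proof.
move=> fA; have [fr fi] := admissible_integrable fA.
have mC := measurable_circle.
rewrite !CintegralE//; last exact: admissible_conj.
rewrite -[RHS]/(Complex _ _) -mulN1r -!RintegralZl//.
by congr Complex; apply: eq_Rintegral => z _; rewrite ?mulN1r; case: (f z).
Qed.

Definition circle_ip (p q : {poly R[i]}) : R[i] :=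
  Cintegral mu (fun z => p.[z]^* * q.[z]).

Lemma admissible_ip (p q : {poly R[i]}) :
  admissible (fun z => p.[z]^* * q.[z]).
Proof.
by apply: admissibleM; [apply: admissible_conj|]; exact: admissible_horner.
Qed.

Lemma reverse_poly_circle n (p : {poly R[i]}) z : (size p <= n.+1)%N ->
  circle z -> (reverse_poly n p).[z] = z ^+ n * (p.[z])^*.
Proof.
move=> pn cz; rewrite horner_poly (horner_coef_wide _ pn) rmorph_sum mulr_sumr/=.
rewrite (reindex_inj rev_ord_inj)/=; apply: eq_bigr => i _.
have le_in : (i <= n)%N by rewrite -ltnS.
rewrite subSS subKn// rmorphM rmorphXn/= mulrCA; congr (_ * _).
have -> : z ^+ n = z ^+ (n - i) * z ^+ i by rewrite -exprD subnK.
by rewrite -mulrA -exprMn [z * _]mulrC circle_conj// expr1n mulr1.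
Qed.

Lemma circle_ip_form : circle_form circle_ip.
Proof.
split.
- move=> p q r; rewrite /circle_ip -CintegralD; do ?exact: admissible_ip.
  by congr (Cintegral mu _); apply/funext => z; rewrite hornerD mulrDr.
- move=> a p q; rewrite /circle_ip -CintegralZ; do ?exact: admissible_ip.
  by congr (Cintegral mu _); apply/funext => z; rewrite hornerZ mulrCA.
- move=> p q; rewrite /circle_ip -Cintegral_conj; do ?exact: admissible_ip.
  by congr (Cintegral mu _); apply/funext => z; rewrite rmorphM/= conjCK mulrC.
- move=> p q; apply: eq_Cintegral; do ?exact: admissible_ip.
  move=> z cz; rewrite !hornerM !hornerX rmorphM/= mulrACA.
  by rewrite circle_conj// mul1r.
- move=> n p q pn qn; apply: eq_Cintegral; do ?exact: admissible_ip.
  move=> z cz; rewrite !reverse_poly_circle// rmorphM/= conjCK rmorphXn/= mulrACA.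
  by rewrite -exprMn circle_conj// expr1n mul1r mulrC.
- rewrite /circle_ip CintegralE; last exact: admissible_ip.
  rewrite (_ : Rintegral _ _ _ = 1); last first.
    rewrite (@eq_Rintegral _ _ _ mu _ (cst 1)); last by move=> z _; rewrite hornerC conjC1 mulr1.
    rewrite (@Rintegral_cst _ _ _ mu _ measurable_circle) mul1r.
    exact: (congr1 fine muC).
  rewrite (_ : Rintegral _ _ _ = 0)//.
  rewrite (@eq_Rintegral _ _ _ mu _ (cst 0)); last by move=> z _; rewrite hornerC conjC1 mulr1.
  by rewrite (@Rintegral_cst _ _ _ mu _ measurable_circle) mul0r.
Qed.

Lemma circle_ip_norm (p : {poly R[i]}) :
  circle_ip p p = (Rintegral mu circle (fun z => Re (`|p.[z]| ^+ 2)))%:C.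
Proof.
rewrite /circle_ip CintegralE; last exact: admissible_ip.
congr Complex.
  by apply: eq_Rintegral => z _; rewrite normCK mulrC.
rewrite (@eq_Rintegral _ _ _ mu _ (cst 0)).
  by rewrite (@Rintegral_cst _ _ _ mu _ measurable_circle) mul0r.
by move=> z _; rewrite mulrC -normCK -add_Re2_Im2.
Qed.

Lemma one_circle : [set (1 : R[i]) : borelC R] `<=` circle.
Proof. by move=> _ ->; rewrite /unit_circle/= normr1. Qed.

(** The integrand |p|^2 dominates its restriction to the point 1. *)
Lemma mass_le_circle_ip (p : {poly R[i]}) :
  (fine (mu [set (1 : R[i])]))%:C * `|p.[1]| ^+ 2 <= circle_ip p p.
Proof.
have m1 := measurable_one; have mC := measurable_circle.
have finC : (mu circle < +oo)%E by rewrite muC ltry.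
rewrite circle_ip_norm -[`|p.[1]| ^+ 2]RRe_real ?rpredX ?normr_real//.
rewrite -rmorphM/= lecR mulrC -Rintegral_cst//.
rewrite Rintegral_mkcond -(setIidr one_circle) -Rintegral_mkcond Rintegral_mkcondr.
have [fi _] := admissible_integrable (admissible_ip p p).
have fN z : Re (p.[z]^* * p.[z]) = Re (`|p.[z]| ^+ 2) by rewrite normCK mulrC.
apply: le_Rintegral => //.
- apply: (measurable_bounded_integrable mC finC).
    by apply/measurable_funTS/(measurable_restrictT _ _).1.
  exists `|Re (`|p.[1]| ^+ 2)|; split; first exact: num_real.
  move=> M BM z cz; rewrite /= patchE; case: ifP => _; first exact: ltW.
  by rewrite normr0 (le_trans _ (ltW BM)).
- by apply: eq_integrable fi => // z _ /=; rewrite fN.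
move=> z cz; rewrite patchE; case: ifPn => [|_]; first by rewrite inE => ->.
by have : 0 <= `|p.[z]| ^+ 2; [rewrite exprn_ge0|rewrite lecE => /andP[]].
Qed.

(** On the circle |(1 + z) / 2|^2 = (1 + Re z) / 2 lies in [0, 1] and equals 1 only at z = 1, so its
    powers tend to the indicator of that point; dominated convergence concludes. *)
Lemma cvg_circle_ip_mass :
  (fun n => Re (circle_ip ((2^-1 *: ('X + 1)) ^+ n) ((2^-1 *: ('X + 1)) ^+ n)))
    @ \oo --> fine (mu [set (1 : R[i])]).
Proof.
have mC := measurable_circle; have m1 := measurable_one.
pose h z := Re (`|(2^-1 *: ('X + 1) : {poly R[i]}).[z]| ^+ 2).
have hE z : circle z -> h z = (1 + Re z) / 2.
  move=> cz; rewrite /h -add_Re2_Im2 hornerZ hornerD hornerX hornerC.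
  have : Re z ^+ 2 + Im z ^+ 2 = 1.
    by apply: (@complexI R); rewrite add_Re2_Im2 (_ : `|z| = 1)// expr1n.
  have [r r2 ->] : exists2 r : R, r = 2^-1 & 2^-1 = r%:C :> R[i].
    by exists 2^-1; rewrite // fmorphV rmorph_nat.
  by case: z {cz} => a b /= ab; simpc => /=; rewrite r2; nra.
have h_ge0 z : 0 <= h z.
  by have : 0 <= `|(2^-1 *: ('X + 1) : {poly R[i]}).[z]| ^+ 2;
    [rewrite exprn_ge0|rewrite lecE => /andP[]].
have mh : measurable_fun [set: borelC R] h.
  rewrite (_ : h = fun z => Re (((2^-1 *: ('X + 1) : {poly R[i]}).[z])^* * (2^-1 *: ('X + 1)).[z])).
    by have [] := admissible_ip (2^-1 *: ('X + 1)) (2^-1 *: ('X + 1)).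
  by apply/funext => z; rewrite mulrC -normCK.
have Re_circle z : circle z -> Re z <= 1 /\ (Re z = 1 -> z = 1).
  move=> cz; have : Re z ^+ 2 + Im z ^+ 2 = 1.
    by apply: (@complexI R); rewrite add_Re2_Im2 (_ : `|z| = 1)// expr1n.
  case: z {cz} => a b /= ab; split; first by nra.
  move=> a1; move: ab; rewrite a1 expr1n => /eqP.
  by rewrite -subr_eq0 addrC addKr sqrf_eq0 => /eqP->.
pose f n (z : borelC R) := ((h z) ^+ n)%:E.
pose l (z : borelC R) : \bar R := (\1_[set (1 : R[i]) : borelC R] z)%:E.
have [_ _ fl] : [/\ mu.-integrable circle l,
    (\int[mu]_(x in circle) `|f n x - l x|)%E @[n --> \oo] --> 0%E &
    (\int[mu]_(x in circle) f n x)%E @[n --> \oo] --> (\int[mu]_(x in circle) l x)%E].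
  apply: (@dominated_convergence _ _ _ mu circle mC f l (cst 1%E)).
  - move=> n; apply/measurable_EFinP/measurable_funTS.
    exact: measurable_funX.
  - by apply/measurable_EFinP/measurable_funTS/measurable_indic.
  - apply: aeW => z cz; rewrite /f /l indicE.
    have [->|/eqP z1] := eqVneq z 1.
      rewrite mem_set// /f hE//; last exact: one_circle.
      rewrite (_ : (1 + Re 1) / 2 = 1); last by rewrite /=; lra.
      by under eq_fun do rewrite expr1n; exact: cvg_cst.
    rewrite memNset//; apply: cvg_EFin; first exact: nearW.
    apply: cvg_expr; rewrite ger0_norm// hE//.
    have [z_le zE] := Re_circle z cz.
    suff : Re z < 1 by lra.
    by rewrite lt_neqAle z_le andbT; apply/eqP => /zE.
  - exact: finite_measure_integrable_cst.
  - apply: aeW => z n cz; rewrite /f /= ger0_norm ?exprn_ge0// lee_fin exprn_ile1//.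
    by rewrite hE//; have [] := Re_circle z cz; lra.
have -> : fine (mu [set (1 : R[i])]) = fine (\int[mu]_(x in circle) l x)%E.
  by rewrite /l integral_indic// setIidl//; exact: one_circle.
rewrite (_ : (fun n => _) = fun n => fine (\int[mu]_(x in circle) f n x)%E).
  apply: fine_cvg => /=; rewrite fineK//.
  by rewrite /l integral_indic// fin_num_measure//; exact: measurableI.
apply/funext => n; rewrite circle_ip_norm; apply: (@eq_Rintegral _ _ _ mu circle) => z _.
rewrite horner_exp normrX /h exprAC -[X in Re (X ^+ n)]RRe_real ?rpredX ?normr_real//.
by rewrite -rmorphXn.
Qed.

End CircleIntegral.

(** * The mass at 1 *)

Section PointMass.
Variable R : realType.
Variables (c g : nat -> R) (alpha : nat -> R[i]).
Hypothesis g01 : forall n, 0 < g n.+1 < 1.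
Hypothesis alphaE : forall n, alpha n =
  (tau c n.+1)^* * (((1 - 2 * g n.+1) -i* c n.+1) / (1 +i* c n.+1)).

Let w n : R[i] := 1 +i* c n.+1.
Let gC n : R[i] := (g n.+1)%:C.

Let wE n : w n + (w n)^* = 2.
Proof. by apply/eqP; rewrite eq_complex /= subrr addr0 -[1 + 1]/(2%:R) !eqxx. Qed.

Let gC01 n : 0 < gC n < 1. Proof. by rewrite !ltcR. Qed.

Let tauS n : tau c n.+1 = (w n)^* / w n * tau c n. Proof. by []. Qed.

Let alphaE' n : alpha n = (tau c n.+1)^* * (((w n)^* - 2 * gC n) / w n).
Proof.
rewrite alphaE; congr (_ * (_ / _)).
by apply/eqP; rewrite eq_complex /= -[1 + 1]/(2%:R); apply/andP; split; apply/eqP; ring.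
Qed.

Lemma mul_conj_tau_alpha n : (tau c n)^* * (alpha n)^* =
  (1 +i* c n.+1 - 2 * (g n.+1)%:C) / (1 +i* c n.+1).
Proof.
rewrite (conj_alpha wE gC01 tauS alphaE') mulrA [_^* * _]mulrC.
by rewrite (tau_unimodular wE (erefl _) tauS) mul1r.
Qed.

(** The mass is the inverse of the sum of the series. Two bounds express this so that a divergent
    series is covered as well; [g] is left general to serve for both [m] and [k]. *)
Lemma point_mass_odds_sum (mu : probability (borelC R) R) :
  verblunsky_coefficients mu alpha ->
  (forall n, fine (mu [set (1 : R[i])]) * odds_sum g n <= 1) /\
  (forall U, (forall n, odds_sum g n <= U) -> 1 <= U * fine (mu [set (1 : R[i])])).
Proof.
move=> [muC _ [Phi PhiO alphaPhi]]; set T := fine _.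
have alphaE'' n : - ((Phi n.+1).[0])^* =
    (tau c n.+1)^* * (((w n)^* - 2 * gC n) / w n) by rewrite -alphaPhi alphaE'.
have ipF := circle_ip_form muC.
have ipO : orthogonal_polynomials (circle_ip mu) Phi.
  move=> n; have [Pm Ps PO] := PhiO n; split=> // j jn.
  rewrite -(PO j jn) /circle_ip; congr (Cintegral mu _); apply/funext => z.
  by rewrite hornerXn rmorphXn.
have lt1 n : `|- ((Phi n.+1).[0])^*| < 1 by exact: (alpha_lt1 wE gC01 (erefl _) tauS alphaE'' n).
have termE n : `|(Phi n).[1]| ^+ 2 / circle_ip mu (Phi n) (Phi n) =
    (\prod_(j < n) (g j.+1 / (1 - g j.+1)))%:C.
  rewrite (christoffel_term ipF ipO lt1 wE gC01 (erefl _) tauS alphaE'') rmorph_prod.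
  by apply: eq_bigr => j _; rewrite rmorphM/= fmorphV/= rmorphB.
have sumE n : \sum_(j < n) `|(Phi j).[1]| ^+ 2 / circle_ip mu (Phi j) (Phi j) =
    (odds_sum g n)%:C.
  by rewrite /odds_sum rmorph_sum; apply: eq_bigr => j _; rewrite termE.
have P0 n : 0 < \prod_(j < n) (g j.+1 / (1 - g j.+1)).
  by apply: prodr_gt0 => j _; have /andP[a b] := g01 j; rewrite divr_gt0// subr_gt0.
split=> [[|n]|U gU].
- by rewrite /odds_sum big_ord0 mulr0.
- have [q [q1 qq]] := christoffel_extremal ipF ipO lt1 n.
  have S0 : 0 < odds_sum g n.+1.
    by rewrite odds_sumS ltr_wpDl// sumr_ge0// => i _; exact: ltW.
  (* For the kernel [q] this reads T S^2 <= S, with S > 0. *)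
  have := mass_le_circle_ip muC q; rewrite qq q1 /christoffel_sum sumE.
  rewrite ger0_norm ?ler0c ?(ltW S0)// -rmorphXn -rmorphM lecR.
  by rewrite expr2 mulrA -[leRHS]mul1r ler_pM2r.
(* The test polynomial has degree at most n and value 1 at 1, so the extremal inequality applies
   before passing to the limit. *)
have step n : 1 <= U * complex.Re (circle_ip mu ((2^-1 *: ('X + 1)) ^+ n)
    ((2^-1 *: ('X + 1)) ^+ n)).
  set p := _ ^+ n.
  have sp : (size p <= n.+1)%N.
    rewrite {}/p; elim: n => [|n IH]; first by rewrite expr0 size_poly1.
    rewrite exprS (leq_trans (size_polyMleq _ _))//.
    have : (size (2^-1 *: ('X + 1) : {poly R[i]}) <= 2)%N.
      by rewrite (leq_trans (size_scale_leq _ _))// size_XaddC.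
    by move: (size _) (size _) IH => x y xn y2; lia.
  have [p0] := eval1_le_christoffel ipF ipO lt1 sp.
  have -> : p.[1] = 1.
    rewrite /p horner_exp hornerZ hornerD hornerX hornerC -[1 + 1]/(2%:R).
    by rewrite mulVf ?pnatr_eq0// expr1n.
  rewrite sumE normr1 expr1n circle_ip_norm// -rmorphM -(rmorph1 (real_complex R)) lecR.
  move=> le1; apply: le_trans le1 _; apply: ler_wpM2r => //.
  by move: p0; rewrite circle_ip_norm// lecR.
have cv : (fun n => U * complex.Re (circle_ip mu ((2^-1 *: ('X + 1)) ^+ n)
    ((2^-1 *: ('X + 1)) ^+ n))) @ \oo --> U * T.
  by apply: cvgMl_tmp; exact: cvg_circle_ip_mass.
rewrite -(cvg_lim _ cv)//; apply: limr_ge; first exact: cvgP cv.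
exact: nearW.
Qed.
End PointMass.

(** * Complementary sequences and the four assertions *)

(** Uniqueness is used twice: the minimal sequence hidden in [a] is [m], and its complement, a
    parameter sequence of [a] starting at 0, is [k]. *)
Lemma minimal_complementary (R : realType) (d m a k : nat -> R) :
  minimal_parameter_sequence d m -> complementary_chain_sequence d a ->
  minimal_parameter_sequence a k -> forall n, k n.+1 = 1 - m n.+1.
Proof.
move=> [mP m0] [m' [m'P m'0] aE] [kP k0] n.
have mE := parameter_sequence_unique m'P mP (etrans m'0 (esym m0)).
have k'P : parameter_sequence a (complementary_parameters m').
  split=> [|i]; first by rewrite lexx ltr01.
  split; last exact: aE.
  by have [_ /(_ i)[/andP[m'0i m'1i] _]] := m'P; rewrite /= subr_gt0 m'1i gtrBl.
by rewrite (parameter_sequence_unique kP k'P k0)/= mE.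
Qed.

(* Termwise, P + 1/P >= 2. *)
Lemma odds_sum_complementary (R : realType) (m k : nat -> R) n :
  (forall j, 0 < m j.+1 < 1) -> (forall j, k j.+1 = 1 - m j.+1) ->
  2 * n%:R <= odds_sum m n + odds_sum k n.
Proof.
move=> m01 kE; rewrite /odds_sum -big_split/=.
have -> : 2 * n%:R = \sum_(i < n) (2 : R).
  by rewrite sumr_const card_ord mulr_natr.
apply: ler_sum => i _.
have -> : \prod_(j < i) (k j.+1 / (1 - k j.+1)) =
    (\prod_(j < i) (m j.+1 / (1 - m j.+1)))^-1.
  rewrite -prodfV; apply: eq_bigr => j _.
  by rewrite kE invf_div; congr (_ / _); ring.
set P := \prod_(j < i) _.
have P0 : 0 < P.
  by apply: prodr_gt0 => j _; have /andP[a b] := m01 j; rewrite divr_gt0// subr_gt0.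
rewrite -subr_ge0; have -> : P + P^-1 - 2 = (P - 1) ^+ 2 / P.
  by field; rewrite gt_eqF.
by rewrite divr_ge0 ?sqr_ge0// ltW.
Qed.

(* In the case c_n = (-1)^n c the source omits the conjugation on alpha; without
   it the identity fails for n = 1 whenever c <> 0. *)
Theorem theorem2p6 (R : realType) (c d M m a k : nat -> R) (t : R)
    (alpha beta : nat -> R[i])
    (d_chain : positive_chain_sequence (fun n => d n.+1))
    (M_max : maximal_parameter_sequence (fun n => d n.+1) (fun n => M n.+1))
    (M1_gt0 : 0 < M 1%N)
    (t_ge0 : 0 <= t) (t_lt1 : t < 1)
    (d1E : d 1%N = (1 - t) * M 1%N)
    (m_min : minimal_parameter_sequence d m)
    (a_compl : complementary_chain_sequence d a)
    (k_min : minimal_parameter_sequence a k)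
    (alphaE : forall n, alpha n =
       (tau c n.+1)^* * (((1 - 2 * m n.+1) -i* c n.+1) / (1 +i* c n.+1)))
    (betaE : forall n, beta n =
       (tau c n.+1)^* * (((1 - 2 * k n.+1) -i* c n.+1) / (1 +i* c n.+1))) :
  [/\ 0 < t ->
        (forall mu : probability (borelC R) R,
           verblunsky_coefficients mu alpha -> mu [set (1 : R[i])] = t%:E) /\
        (forall nu : probability (borelC R) R,
           verblunsky_coefficients nu beta -> nu [set (1 : R[i])] = 0%E),
      forall n, beta n = - ((tau c n.+1)^* * (tau c n)^* * (alpha n)^*),
      forall x : R, (forall n, (0 < n)%N -> c n = (-1) ^+ n * x) ->
        forall n, beta n = - ((1 -i* x) / (1 +i* x) * (alpha n)^*) &
      (forall n, (0 < n)%N -> c n = 0) ->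
        forall n, [/\ alpha n \is Num.real, beta n \is Num.real &
                      beta n = - alpha n]].
Proof.
have kE := minimal_complementary m_min a_compl k_min.
have m01 n : 0 < m n.+1 < 1 by case: m_min => -[_ /(_ n)[]].
have k01 n : 0 < k n.+1 < 1.
  by have /andP[a0 a1] := m01 n; rewrite kE subr_gt0 a1 gtrBl.
(* After cancelling the phases, the numerators agree: 1 - 2 (1 - m) - i c = -(1 + i c - 2 m). *)
have bE n : beta n = - ((tau c n.+1)^* * (tau c n)^* * (alpha n)^*).
  rewrite betaE kE -mulrA (mul_conj_tau_alpha m01 alphaE) -[RHS]mulrN -[- (_ / _)]mulNr.
  congr (_ * (_ / _)); apply/eqP; rewrite eq_complex /= -[1 + 1]/(2%:R).
  by apply/andP; split; apply/eqP; ring.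
split=> //.
- move=> t0; have t01 : 0 < t < 1 by rewrite t0.
  have [S_le S_sup] := odds_sum_sup d_chain M_max M1_gt0 t01 d1E m_min.
  split=> [mu muV|nu nuV].
    have [TS TU] := point_mass_odds_sum m01 alphaE muV.
    rewrite -[LHS]fineK ?fin_num_measure//; last exact: measurable_one.
    congr EFin; move: TS TU; set T := fine _ => TS TU.
    (* The bound 1 / t on the sums gives t <= T; then 1 / T bounds the sums too, and leastness of 1
       / t gives the converse. *)
    have tT : t <= T by have := TU _ S_le; rewrite ler_pdivlMl// mulr1.
    have T0 : 0 < T by exact: lt_le_trans tT.
    apply/eqP; rewrite eq_le tT andbT -[T]invrK -[t]invrK lef_pV2 ?posrE ?invr_gt0//.
    by apply: S_sup => n; rewrite -[T^-1]mulr1 ler_pdivlMl.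
  have [TS _] := point_mass_odds_sum k01 betaE nuV.
  rewrite -[LHS]fineK ?fin_num_measure//; last exact: measurable_one.
  congr EFin; move: TS; set T := fine _ => TS.
  have : 0 <= T by rewrite fine_ge0.
  rewrite le_eqVlt => /predU1P[//|T0]; exfalso.
  (* A positive mass T would bound the sums for [k] by 1 / T, while those for [m] stay below 1 / t;
     together they grow at least like 2 n. *)
  have le_all n : 2 * n%:R <= t^-1 + T^-1.
    apply: le_trans (odds_sum_complementary n m01 kE) _; apply: lerD => //.
    by rewrite -[T^-1]mulr1 ler_pdivlMl.
  have := le_all (Num.truncn (t^-1 + T^-1)).+1.
  have : t^-1 + T^-1 < (Num.truncn (t^-1 + T^-1)).+1%:R by exact: truncnS_gt.
  by have := ler0n R (Num.truncn (t^-1 + T^-1)).+1; lra.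
- move=> x cx n; rewrite bE; congr (- (_ * _)).
  set u : R[i] := 1 +i* x; set v : R[i] := 1 -i* x.
  have u0 : u != 0 by rewrite eq_complex /= oner_eq0.
  have v0 : v != 0 by rewrite eq_complex /= oner_eq0.
  (* The factors of [tau] alternate between u / v and its inverse, so two consecutive values always
     multiply to u / v. *)
  have tauE j : tau c j = if odd j then u / v else 1.
    elim: j => //= j ->; rewrite cx// -signr_odd/=.
    case: odd => /=; rewrite ?expr0 ?expr1 ?mul1r ?mulN1r ?opprK ?mulr1 -/u -/v//.
    by field; rewrite u0 v0.
  rewrite -rmorphM !tauE -[odd n.+1]/(~~ odd n); have uv : (u / v)^* = v / u.
    by rewrite rmorphM fmorphV/=; congr (_ / _); apply/eqP; rewrite eq_complex /= opprK !eqxx.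
  by case: odd; rewrite /negb ?mulr1 ?mul1r; exact: uv.
- move=> c0 n.
  have one0 : 1 -i* 0 = 1 :> R[i] by rewrite oppr0.
  have tauE j : tau c j = 1.
    by elim: j => //= j ->; rewrite c0// one0 divr1 mulr1.
  have real_coef g : ((1 - 2 * g) -i* c n.+1) / (1 +i* c n.+1) = (1 - 2 * g)%:C.
    by rewrite c0// oppr0 divr1.
  rewrite alphaE betaE !tauE conjC1 !mul1r !real_coef//; split.
  - by apply/complex_realP; eexists.
  - by apply/complex_realP; eexists.
  - by rewrite kE -rmorphN; congr (_%:C); ring.
Qed.
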